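(* Let $X$ be a real Banach space with $\dim X\ge 2$ and let $0\le p\le 1$. Then $$1\le \mathcal{MR}_p(X)\le 2.$$
   Context: For $p\in\mathbb{R}$ and nonzero $x_1,x_2\in X$, the $p$-angular distance and the skew $p$-angular distance are $$\alpha_p[x_1,x_2]=\left\|\frac{x_1}{\|x_1\|^{1-p}}-\frac{x_2}{\|x_2\|^{1-p}}\right\|,\qquad \beta_p[x_1,x_2]=\left\|\frac{x_1}{\|x_2\|^{1-p}}-\frac{x_2}{\|x_1\|^{1-p}}\right\|.$$ For $0\le p\le 1$ the Maligranda-Rooin constant is $$\mathcal{MR}_p(X)=\sup\left\{\frac{\alpha_p[x_1,x_2]}{\beta_p[x_1,x_2]}:\ x_1,x_2\in X\setminus\{0\},\ \beta_p[x_1,x_2]\ne 0\right\}.$$ *)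

(* Defs.v *)
From HB Require Import structures.
From mathcomp Require Import all_boot all_order all_algebra.
From mathcomp Require Import all_classical all_reals all_analysis.

Set Implicit Arguments.
Unset Strict Implicit.
Unset Printing Implicit Defensive.

Import Order.TTheory GRing.Theory Num.Theory.
Import numFieldNormedType.Exports.

Local Open Scope classical_set_scope.
Local Open Scope ring_scope.

(* [X] is not assumed finite-dimensional, so [dim X >= n] is expressed by a
   linearly independent family of [n] vectors. *)
Definition lin_indep (R : realType) (X : normedModType R) (n : nat)
    (v : 'I_n -> X) : Prop :=
  forall c : 'I_n -> R, \sum_(i < n) c i *: v i = 0 -> forall i, c i = 0.

Definition dim_ge (R : realType) (X : normedModType R) (n : nat) : Prop :=
  exists v : 'I_n -> X, lin_indep v.

Definition angular_dist (R : realType) (X : normedModType R) (p : R)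
    (x1 x2 : X) : R :=
  `| (`|x1| `^ (1 - p))^-1 *: x1 - (`|x2| `^ (1 - p))^-1 *: x2 |.

Definition skew_angular_dist (R : realType) (X : normedModType R) (p : R)
    (x1 x2 : X) : R :=
  `| (`|x2| `^ (1 - p))^-1 *: x1 - (`|x1| `^ (1 - p))^-1 *: x2 |.

(* The supremum is taken in the extended reals, since the real-valued [sup]
   returns 0 on unbounded sets. *)
Definition Maligranda_Rooin (R : realType) (X : normedModType R) (p : R) :
    \bar R :=
  ereal_sup [set r : \bar R | exists x1 x2 : X,
    [/\ x1 != 0, x2 != 0, skew_angular_dist p x1 x2 != 0
      & r = (angular_dist p x1 x2 / skew_angular_dist p x1 x2)%:E]].
Arguments Maligranda_Rooin {R} X p.
Arguments dim_ge {R} X n.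

(* Main.v *)
(** Both distances have the form [`|u x1 - v x2|] and [`|v x1 - u x2|] with
    [u = `|x1|^(p - 1)] and [v = `|x2|^(p - 1)].  By symmetry let
    [`|x1| <= `|x2|]; as [0 <= p <= 1], then [v <= u] and
    [u `|x1| <= v `|x2|].  In the decomposition
    [u (u x1 - v x2) = v (v x1 - u x2) + (u^2 - v^2) x1] the last term has norm
    at most [v (u `|x2| - v `|x1|) <= v `|v x1 - u x2|], so the ratio is at
    most [2 v / u <= 2].  The pair [x, - x] has ratio [1]. *)
Require Import Defs.
From HB Require Import structures.
From mathcomp Require Import all_boot all_order all_algebra.
From mathcomp Require Import all_classical all_reals all_analysis.
From mathcomp Require Import ring lra.
Import Order.TTheory GRing.Theory Num.Theory.
Import numFieldNormedType.Exports.
Local Open Scope ring_scope.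

Lemma swap_coef_norm_le (R : realType) (X : normedModType R) (u v : R)
    (x y : X) :
  0 < v -> v <= u -> u * `|x| <= v * `|y| ->
  `|u *: x - v *: y| <= 2 * `|v *: x - u *: y|.
Proof.
move=> v0 vu uxvy; have u0 : 0 < u := lt_le_trans v0 vu.
have decomp : u *: (u *: x - v *: y) =
    v *: (v *: x - u *: y) + (u ^+ 2 - v ^+ 2) *: x.
  rewrite !scalerBr !scalerA scalerBl (mulrC v u) !expr2.
  by rewrite [RHS]addrC [RHS]addrA subrK.
have v2u2 : 0 <= u ^+ 2 - v ^+ 2 by rewrite subr_ge0 ler_sqr // nnegrE ltW.
have tri : u * `|u *: x - v *: y| <=
    v * `|v *: x - u *: y| + (u ^+ 2 - v ^+ 2) * `|x|.
  have := ler_normD (v *: (v *: x - u *: y)) ((u ^+ 2 - v ^+ 2) *: x).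
  by rewrite -decomp !normrZ (gtr0_norm u0) (gtr0_norm v0) (ger0_norm v2u2).
have beta : u * `|y| - v * `|x| <= `|v *: x - u *: y|.
  have := lerB_dist (u *: y) (v *: x).
  by rewrite !normrZ (gtr0_norm u0) (gtr0_norm v0) distrC.
have b0 := normr_ge0 (v *: x - u *: y).
rewrite -(ler_pM2l u0).
(* These products make the goal linear in its monomials: [u ^+ 2 * |x| <= u * v * |y|] and [beta]
   times [v] bound the last term of [tri], and [v <= u] turns the resulting factor [2 * v] into
   [2 * u]. *)
have := ler_wpM2l (ltW v0) beta.
have := ler_wpM2l (ltW u0) uxvy.
have := ler_wpM2r b0 vu.
nra.
Qed.

Lemma mul_invr_powR_oneB (R : realType) (p a : R) :
  0 < a -> (a `^ (1 - p))^-1 * a = a `^ p.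
Proof.
move=> a0; rewrite -powRN -[X in _ * X](powRr1 (ltW a0)) -powRD.
  by congr (_ `^ _); ring.
(* Adding exponents requires a nonzero base when they sum to [0], here when [p = 0]. *)
by rewrite (gt_eqF a0) implybT.
Qed.

Lemma angular_dist_le2 (R : realType) (X : normedModType R) (p : R)
    (x y : X) :
  0 <= p <= 1 -> x != 0 -> y != 0 ->
  angular_dist p x y <= 2 * skew_angular_dist p x y.
Proof.
move=> /andP[p0 p1].
wlog xy : x y / `|x| <= `|y| => [sym x0 y0|].
  have [|/ltW yx] := leP `|x| `|y|; first by move=> xy; exact: sym.
  by have := sym y x yx y0 x0; rewrite /angular_dist /skew_angular_dist distrC
    [X in _ <= 2 * X -> _]distrC.
rewrite -normr_gt0 -[y != 0]normr_gt0 => x0 y0.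
apply: swap_coef_norm_le.
- by rewrite invr_gt0 powR_gt0.
(* Here [p <= 1] enters, through the exponent [1 - p]. *)
- rewrite lef_pV2 ?posrE ?powR_gt0 //.
  by apply: ge0_ler_powR; rewrite ?nnegrE ?subr_ge0.
(* Here [0 <= p] enters: both sides become [p]-th powers of the norms. *)
- by rewrite !mul_invr_powR_oneB //; apply: ge0_ler_powR; rewrite ?nnegrE.
Qed.

Lemma angular_distN (R : realType) (X : normedModType R) (p : R) (x : X) :
  angular_dist p x (- x) = skew_angular_dist p x (- x).
Proof. by rewrite /angular_dist /skew_angular_dist normrN. Qed.

(** Makes the pair [x, - x] admissible in the supremum: its two terms are equal positive multiples
    of [x] that add up. *)
Lemma skew_angular_distN_neq0 (R : realType) (X : normedModType R) (p : R)
    (x : X) :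
  x != 0 -> skew_angular_dist p x (- x) != 0.
Proof.
move=> x0; rewrite /skew_angular_dist normrN scalerN opprK -scalerDl.
rewrite normr_eq0 scaler_eq0 negb_or x0 andbT gt_eqF //.
by rewrite addr_gt0 // invr_gt0 powR_gt0 // normr_gt0.
Qed.

Lemma dim_ge_neq0 (R : realType) (X : normedModType R) (n : nat) :
  dim_ge X n.+1 -> exists x : X, x != 0.
Proof.
move=> [v indep]; exists (v ord0); apply/eqP => v0.
(* If [v ord0] vanished, this indicator would give a nontrivial linear relation. *)
pose c (i : 'I_n.+1) : R := (i == ord0)%:R.
have /indep/(_ ord0)/eqP : \sum_i c i *: v i = 0.
  apply: big1 => i _; rewrite /c; case: eqP => [->|_]; last by rewrite scale0r.
  by rewrite v0 scaler0.
by rewrite /c eqxx oner_eq0.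
Qed.

Theorem proposition3p2 (R : realType) (X : completeNormedModType R) (p : R)
    (hdim : dim_ge X 2) (hp0 : 0 <= p) (hp1 : p <= 1) :
  (1%:E <= Maligranda_Rooin X p /\ Maligranda_Rooin X p <= 2%:E)%E.
Proof.
split.
  have [x x0] := @dim_ge_neq0 _ _ 1 hdim.
  apply: ereal_sup_ubound; exists x, (- x).
  have skew0 := @skew_angular_distN_neq0 _ _ p _ x0.
  by split; rewrite ?oppr_eq0 // angular_distN divff.
apply: ge_ereal_sup => _ [x [y [x0 y0 skew0 ->]]].
rewrite lee_fin ler_pdivrMr; last by rewrite lt_def skew0 normr_ge0.
by apply: angular_dist_le2; rewrite ?hp0.
Qed.
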